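(* Let $A$ be a finite or countably infinite alphabet, let $K$ be a field of characteristic zero, and let $B=\{\beta_1,\beta_2,\dots\}\subseteq A^*$ be a (finite or countably infinite) set of words, each of length at least $2$. Let $G$ be a digraph on the vertex set $[m]$ and let $(G,P)$ be a monoid network on $A^*$. Then, in the ring of $m\times m$ matrices over $K\langle\langle A^*\rangle\rangle[[t_1,t_2,\dots]]$, \[ \overrightarrow{F}_{G}(t_1,t_2,\dots)=\Big(I_m-\sum_{p\in P}M_p-\overrightarrow{L}_{G}(t_1-1,t_2-1,\dots)\Big)^{-1}. \]
   Context: $A^*$ is the free monoid of finite words over $A$ (including the empty word $1$), $K\langle\langle A^*\rangle\rangle$ is the algebra of formal (possibly infinite) $K$-linear combinations of words in $A^*$, and $t_1,t_2,\dots$ are indeterminates commuting with each other and with the letters. A word $\beta$ is a subword of $\alpha$ if $\alpha=\gamma_1\beta\gamma_2$; for $\gamma\in A^*$, $\mathrm{bad}_k(\gamma)$ is the number of occurrences of $\beta_k$ as a subword of $\gamma$. Monoid network: $G$ is a digraph on $[m]$ whose arcs $(i,j)$ are each assigned a set $P_{i,j}\subseteq A$; $P$ is the set of all pairs $(a,e)$ with $e=(i,j)$ an arc of $G$ and $a\in P_{i,j}$, regarded as an alphabet. $\overrightarrow{P^*}\subseteq P^*$ is the set of sequences $\alpha=(a_1,e_1)\cdots(a_n,e_n)$ such that $e_1\cdots e_n$ is a walk in $G$; for such $\alpha$, $\rho(\alpha)=a_1\cdots a_n\in A^*$ and, if $n\ge 1$, $E(\alpha)=(i,j)$ where $i,j$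 are the initial and terminal vertices of the walk. $(G,P)$ is a monoid network if for all nonempty $\alpha,\beta\in\overrightarrow{P^*}$, $\rho(\alpha)=\rho(\beta)$ and $E(\alpha)=E(\beta)$ imply $\alpha=\beta$. Matrices: for $p=(a,(i,j))\in P$, $M_p$ is the $m\times m$ matrix with $a$ in entry $(i,j)$ and $0$ elsewhere; for nonempty $\alpha\in\overrightarrow{P^*}$ with $E(\alpha)=(i,j)$, $M_\alpha$ is the $m\times m$ matrix with $\rho(\alpha)$ in entry $(i,j)$ and $0$ elsewhere. $I_m$ is the identity matrix. $\overrightarrow{F}_G(t_1,t_2,\dots)$ is the $m\times m$ matrix whose $(i,j)$ entry is $\sum_\alpha \rho(\alpha)\prod_k t_k^{\mathrm{bad}_k(\rho(\alpha))}$, summed over all $\alpha\in\overrightarrow{P^*}$ corresponding to walks from $i$ to $j$ (the empty sequence counting as a walk from $i$ to $i$ for every $i$), i.e. it is the generating function of words readable along walks from $i$ to $j$, weighted by occurrences of each $\beta_k$. Clusters: let $\overrightarrow{B}_u=\{\alpha\in\overrightarrow{P^*}:\rho(\alpha)=\beta_u\}$ and $\overrightarrow{B}=\bigcup_u\overrightarrow{B}_u$. For $\alpha=p_1\cdots p_n\in P^*$, a marked subword of $\alpha$ is a pair $(i,\gamma)$ with $\gamma\in\overrightarrow{B}$ and $\gamma=p_ip_{i+1}\cdots p_{i+l(\gamma)-1}$; a marked word is a pair $(\alpha,S)$ with $S$ a set of marked subwords of $\alpha$. Marked words are concatenated by concatenating the words and taking the union of the mark sets (with positions of the second shifted). A cluster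 on $\alpha$ is a marked word $(\alpha,S)$ with $S\neq\emptyset$ that is not the concatenation of two marked words with nonempty underlying words. $C_\alpha$ is the set of clusters on $\alpha$, and for a cluster $c$, $\mathrm{mk}_u(c)$ is the number of its marked subwords $(v,\gamma)$ with $\gamma\in\overrightarrow{B}_u$. The cluster matrix is \[ \overrightarrow{L}_G(t_1,t_2,\dots)=\sum_{\alpha\in\overrightarrow{P^*}}M_\alpha\sum_{c\in C_\alpha}\prod_k t_k^{\mathrm{mk}_k(c)}. \] *)

(* Defs.v *)
From HB Require Import structures.
From mathcomp Require Import all_boot all_order all_algebra.
From mathcomp Require Import finmap multiset.
From mathcomp Require Import boolp classical_sets functions cardinality fsbigop.

Set Implicit Arguments.
Unset Strict Implicit.
Unset Printing Implicit Defensive.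

Import GRing.Theory.

Local Open Scope mset_scope.
Local Open Scope classical_set_scope.
Local Open Scope ring_scope.

(* Monoids in which every element has finitely many factorisations; this is
   what makes the convolution of formal series over the monoid a finite sum. *)
HB.mixin Record isFactMonoid M of Choice M := {
  fm1 : M;
  fmM : M -> M -> M;
  fmA : associative fmM;
  fm1m : left_id fm1 fmM;
  fmm1 : right_id fm1 fmM;
  fm_finite : forall d, finite_set [set p : M * M | fmM p.1 p.2 = d] }.

#[short(type="factMonoidType")]
HB.structure Definition FactMonoid := {M of isFactMonoid M & Choice M}.

Definition facts (M : factMonoidType) (d : M) : set (M * M) :=
  [set p | fmM p.1 p.2 = d].

Section Words.
Context (A : choiceType).

Lemma word_factors_finite (w : seq A) :
  finite_set [set p : seq A * seq A | p.1 ++ p.2 = w].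
Proof.
apply: (@sub_finite_set _ _
  [set` [seq (take i w, drop i w) | i <- iota 0 (size w).+1]]).
  move=> [u v] <-; apply/mapP; exists (size u).
    by rewrite mem_iota /= add0n ltnS size_cat leq_addr.
  by rewrite /= take_size_cat // drop_size_cat.
exact: finite_seq.
Qed.

HB.instance Definition _ :=
  isFactMonoid.Build (seq A) (@catA A) (@cat0s A) (@cats0 A)
    word_factors_finite.

End Words.

(* The monomials in commuting indeterminates t_k, k : I, are the finite
   multisets of indices. *)
Section Monomials.
Context (I : choiceType).

Lemma mset_factors_finite (d : {mset I}) :
  finite_set [set p : {mset I} * {mset I} | msetD p.1 p.2 = d].
Proof.
pose T := {ffun finsupp d -> 'I_(size d).+1}.
pose g (a : T) : {mset I} :=
  [mset[tt] x in finsupp d => if insub x is Some y then a y : nat else 0%N].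
apply: (@sub_finite_set _ _
  ((fun a : T * T => (g a.1, g a.2)) @` setT)); last first.
  exact/finite_image/finite_finset.
have rg (u : {mset I}) : (forall x, u x <= d x)%N -> exists a, g a = u.
  move=> ud.
  exists [ffun y => inord (u (val y))]; apply/msetP => x.
  rewrite /g fsfunE; case: ifPn => xd; last first.
    move: (ud x); rewrite (fsfun_dflt xd) leqn0 => /eqP -> //.
  rewrite (insubT (fun x => x \in finsupp d) xd) ffunE inordK //= ltnS.
  by apply: leq_trans (ud x) _; rewrite -count_mem_mset count_size.
move=> [u v] /= uvd.
have [|a ga] := rg u; first by move=> x; rewrite -uvd msetE2 leq_addr.
have [|b gb] := rg v; first by move=> x; rewrite -uvd msetE2 leq_addl.
by exists (a, b) => //=; rewrite ga gb.
Qed.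

HB.instance Definition _ := Choice.on {mset I}.
HB.instance Definition _ :=
  isFactMonoid.Build {mset I} (@msetDA I) (@mset0D I) (@msetD0 I)
    mset_factors_finite.

End Monomials.

Record fseries (M : factMonoidType) (R : pzRingType) :=
  FSeries { coefs :> M -> R }.

Section FSeriesRing.
Context (M : factMonoidType) (R : pzRingType).
Implicit Types f g h : fseries M R.

HB.instance Definition _ := gen_eqMixin (fseries M R).
HB.instance Definition _ := gen_choiceMixin (fseries M R).

Lemma fseriesP f g : (forall d, f d = g d) <-> f = g.
Proof.
split=> [|-> //]; case: f g => [f] [g] /= fg; congr FSeries.
exact/funext.
Qed.

Definition fs_zero : fseries M R := FSeries (fun=> 0).
Definition fs_add f g : fseries M R := FSeries (fun d => f d + g d).
Definition fs_opp f : fseries M R := FSeries (fun d => - f d).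

(* The series r.d, with the single coefficient r at d. *)
Definition fs_term (d : M) (r : R) : fseries M R :=
  FSeries (fun e => if e == d then r else 0).

Definition fs_mul f g : fseries M R :=
  FSeries (fun d => \sum_(p \in facts d) f p.1 * g p.2).

Fact fs_addA : associative fs_add.
Proof. by move=> f g h; apply/fseriesP => d /=; rewrite addrA. Qed.
Fact fs_addC : commutative fs_add.
Proof. by move=> f g; apply/fseriesP => d /=; rewrite addrC. Qed.
Fact fs_add0 : left_id fs_zero fs_add.
Proof. by move=> f; apply/fseriesP => d /=; rewrite add0r. Qed.
Fact fs_addN : left_inverse fs_zero fs_opp fs_add.
Proof. by move=> f; apply/fseriesP => d /=; rewrite addNr. Qed.

HB.instance Definition _ :=
  GRing.isZmodule.Build (fseries M R) fs_addA fs_addC fs_add0 fs_addN.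

Let fl (d : M) : seq (M * M) := fset_set (facts d).

Let fl_uniq d : uniq (fl d). Proof. exact: fset_uniq. Qed.

Let mem_fl d (p : M * M) : (p \in fl d) = (fmM p.1 p.2 == d).
Proof.
rewrite /fl in_fset_set; last exact: fm_finite.
by apply/idP/eqP; rewrite inE.
Qed.

Let fs_mulE f g d : fs_mul f g d = \sum_(p <- fl d) f p.1 * g p.2.
Proof. by rewrite /= fsbig_finite //; exact: fm_finite. Qed.

Fact fs_mulA : associative fs_mul.
Proof.
move=> f g h; apply/fseriesP => d; rewrite !fs_mulE.
under eq_bigr do rewrite fs_mulE mulr_sumr.
under [RHS]eq_bigr do rewrite fs_mulE mulr_suml.
pose F (x : M * (M * M)) := f x.1 * (g x.2.1 * h x.2.2).
transitivity (\sum_(x <- [seq (p.1, q) | p <- fl d, q <- fl p.2]) F x).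
  by rewrite big_allpairs_dep.
transitivity
  (\sum_(x <- [seq (q.1, (q.2, p.2)) | p <- fl d, q <- fl p.1]) F x);
  last first.
  by rewrite big_allpairs_dep; do 2!apply: eq_bigr => ? _; rewrite /F mulrA.
apply/perm_big/uniq_perm.
- apply: allpairs_uniq_dep => // z z'.
  move=> /allpairsPdep[[a b] [[u v] [_ + ->]]].
  move=> + /allpairsPdep[[a' b'] [[u' v'] [_ + ->]]].
  rewrite !mem_fl /= => /eqP + /eqP + [e1 e2 e3].
  by rewrite e1 e2 e3 => <- <-.
- apply: allpairs_uniq_dep => // z z'.
  move=> /allpairsPdep[[a b] [[u v] [_ + ->]]].
  move=> + /allpairsPdep[[a' b'] [[u' v'] [_ + ->]]].
  rewrite !mem_fl /= => /eqP + /eqP + [e1 e2 e3].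
  by rewrite e1 e2 e3 => <- <-.
- move=> [x [y z]]; apply/allpairsPdep/allpairsPdep => /=.
    move=> [[p1 p2]] [[q1 q2]] []; rewrite !mem_fl /= => /eqP e1 /eqP e2.
    move=> [-> -> ->]; exists (fmM p1 q1, q2), (p1, q1).
    by rewrite !mem_fl /= -e1 -e2 fmA !eqxx.
  move=> [[p1 p2]] [[q1 q2]] []; rewrite !mem_fl /= => /eqP e1 /eqP e2.
  move=> [-> -> ->]; exists (q1, fmM q2 p2), (q2, p2).
  by rewrite !mem_fl /= -e1 -e2 fmA !eqxx.
Qed.

Fact fs_mul1 : left_id (fs_term fm1 1) fs_mul.
Proof.
move=> f; apply/fseriesP => d; rewrite fs_mulE.
rewrite (bigD1_seq (fm1, d)) ?mem_fl ?fm1m //= eqxx mul1r.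
rewrite big_seq_cond big1 ?addr0 // => -[a b] /=; rewrite mem_fl /=.
case: (a =P fm1) => [->|_ _]; last by rewrite mul0r.
by rewrite fm1m => /andP[/eqP ->]; rewrite eqxx.
Qed.

Fact fs_mulr1 : right_id (fs_term fm1 1) fs_mul.
Proof.
move=> f; apply/fseriesP => d; rewrite fs_mulE.
rewrite (bigD1_seq (d, fm1)) ?mem_fl ?fmm1 //= eqxx mulr1.
rewrite big_seq_cond big1 ?addr0 // => -[a b] /=; rewrite mem_fl /=.
case: (b =P fm1) => [->|_ _]; last by rewrite mulr0.
by rewrite fmm1 => /andP[/eqP ->]; rewrite eqxx.
Qed.

Fact fs_mulDl : left_distributive fs_mul fs_add.
Proof.
move=> f g h; apply/fseriesP => d.
transitivity (fs_mul f h d + fs_mul g h d); last by [].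
rewrite !fs_mulE -big_split /=.
by apply: eq_bigr => p _; rewrite mulrDl.
Qed.

Fact fs_mulDr : right_distributive fs_mul fs_add.
Proof.
move=> f g h; apply/fseriesP => d.
transitivity (fs_mul f g d + fs_mul f h d); last by [].
rewrite !fs_mulE -big_split /=.
by apply: eq_bigr => p _; rewrite mulrDr.
Qed.

HB.instance Definition _ := GRing.Zmodule_isPzRing.Build (fseries M R)
  fs_mulA fs_mul1 fs_mulr1 fs_mulDl fs_mulDr.

End FSeriesRing.

(* K<<A*>>[[t_k : k in I]] *)
Definition wseries (A I : choiceType) (K : pzRingType) : pzRingType :=
  fseries {mset I} (fseries (seq A) K).

Section WSeries.
Context {A I : choiceType} {K : pzRingType}.

Definition word (w : seq A) : wseries A I K := fs_term mset0 (fs_term w 1).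

Definition tvar (k : I) : wseries A I K := fs_term [mset k]%mset 1.

(* The sum of a possibly infinite family, meaningful when every monomial t^d w
   has a nonzero coefficient in finitely many members only. *)
Definition fsum (X : choiceType) (D : set X) (f : X -> wseries A I K) :
  wseries A I K :=
  FSeries (fun d => FSeries (fun w => \sum_(x \in D) f x d w)).

Definition mxfsum (m : nat) (X : choiceType) (D : set X)
    (f : X -> 'M[wseries A I K]_m) : 'M[wseries A I K]_m :=
  \matrix_(i, j) fsum D (fun x => f x i j).

(* prod_k x_k^(n_k), for n with finite support *)
Definition wprod (x : I -> wseries A I K) (n : I -> nat) : wseries A I K :=
  \big[*%R/1]_(k \in [set: I]) x k ^+ n k.

End WSeries.

(* Number of occurrences of b as a contiguous subword of w. *)
Definition bad (A : eqType) (b w : seq A) : nat :=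
  count (fun i => prefix b (drop i w)) (iota 0 (size w).+1).

Section Network.
Context {A : choiceType} {m : nat}.

(* (a, (i, j)) stands for the letter a placed on the arc (i, j). *)
Definition arcletter := (A * ('I_m * 'I_m))%type.
Implicit Types (p : arcletter) (al ga : seq arcletter).

Context (G : rel 'I_m) (P : 'I_m -> 'I_m -> set A).

Definition Pset : set arcletter :=
  [set p | G p.2.1 p.2.2 /\ P p.2.1 p.2.2 p.1].

Definition Pwords : set (seq arcletter) :=
  [set al | forall p, p \in al -> Pset p].

Definition walks : set (seq arcletter) :=
  [set al | Pwords al /\ sorted (fun p q => p.2.2 == q.2.1) al].

Definition rho al : seq A := [seq p.1 | p <- al].

Definition ends al : option ('I_m * 'I_m) :=
  if al is p :: s then Some (p.2.1, (last p s).2.2) else None.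

Definition walks_from_to (i j : 'I_m) : set (seq arcletter) :=
  [set al | walks al /\ (ends al = Some (i, j) \/ al = [::] /\ i = j)].

Definition monoid_network : Prop := forall al al',
  walks al -> walks al' -> al != [::] -> al' != [::] ->
  rho al = rho al' -> ends al = ends al' -> al = al'.

Context {I : choiceType} (K : pzRingType) (beta : I -> seq A).
Local Notation W := (wseries A I K).

Definition Mletter p : 'M[W]_m :=
  \matrix_(i, j) if p.2 == (i, j) then word [:: p.1] else 0.

(* Only meaningful for nonempty walks; it is 0 on the empty one. *)
Definition Mwalk al : 'M[W]_m :=
  \matrix_(i, j) if ends al == Some (i, j) then word (rho al) else 0.

Definition walk_gf : 'M[W]_m :=
  \matrix_(i, j) fsum (walks_from_to i j)
    (fun al => word (rho al) * wprod tvar (fun k => bad (beta k) (rho al))).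

Definition Barrow (u : I) : set (seq arcletter) :=
  [set ga | walks ga /\ rho ga = beta u].

(* A mark (i, ga) records the occurrence of ga starting at position i, with
   positions counted from 0. *)
Definition mark := (nat * seq arcletter)%type.
Definition mword := (seq arcletter * {fset mark})%type.

Definition marked_subword al (s : mark) : Prop :=
  (exists u, Barrow u s.2) /\ prefix s.2 (drop s.1 al).

Definition marked_word (c : mword) : Prop :=
  Pwords c.1 /\ forall s, s \in c.2 -> marked_subword c.1 s.

Definition mword_cat (c c' : mword) : mword :=
  (c.1 ++ c'.1,
   (c.2 `|` [fset ((s.1 + size c.1)%N, s.2) | s : mark in c'.2])%fset).

Definition cluster (c : mword) : Prop :=
  [/\ marked_word c, c.2 != fset0 &
   ~ exists c1 c2, [/\ marked_word c1, marked_word c2,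
       c1.1 != [::], c2.1 != [::] & c = mword_cat c1 c2]].

Definition clusters_on al : set mword := [set c | c.1 = al /\ cluster c].

Definition mk (u : I) (c : mword) : nat :=
  #|` [fset s in c.2 | `[< Barrow u s.2 >]]%fset |.

(* L_G(x_1, x_2, ...); the scalar weights may be put on the left since they are
   central for the families x built from the t_k. *)
Definition cluster_mx (x : I -> W) : 'M[W]_m :=
  mxfsum walks
    (fun al => (\sum_(c \in clusters_on al) wprod x (mk^~ c)) *: Mwalk al).

End Network.

(* Main.v *)
(* Substituting t_k = 1 + x_k in the weight t^bad of a walk turns it into the
   sum of x^S over all sets S of marked subwords of the walk.  A nonempty marked
   walk factors uniquely as an indecomposable marked walk followed by an
   arbitrary one: cut it at the first position >= 1 that no mark straddles.  The
   indecomposable marked walks are the clusters and the unmarked letters, whence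
   F = I + X F, where X is the sum of the letter matrices and of the cluster
   matrix; that is, (I - X) F = I.  Since X has no term in the empty word,
   Y = X Y forces Y = 0, and applying this to Y = F (I - X) - I gives the other
   identity.  Everything is read off word coefficient by word coefficient, in
   the commutative ring of power series in the t_k. *)

Require Import Defs.
From HB Require Import structures.
From mathcomp Require Import all_boot all_order all_algebra.
From mathcomp Require Import finmap multiset.
From mathcomp Require Import boolp classical_sets functions cardinality fsbigop.

Set Implicit Arguments.
Unset Strict Implicit.
Unset Printing Implicit Defensive.

Import GRing.Theory.
Local Open Scope mset_scope.
Local Open Scope ring_scope.

(** * Word coefficients of formal series *)

Lemma big_uniq_support (R : Type) (idx : R) (op : Monoid.com_law idx)
    (X : eqType) (r s : seq X) (F : X -> R) : uniq r -> uniq s ->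
  {in s, forall x, x \notin r -> F x = idx} ->
  {in r, forall x, x \notin s -> F x = idx} ->
  \big[op/idx]_(x <- r) F x = \big[op/idx]_(x <- s) F x.
Proof.
move=> ur us Hs Hr.
rewrite (bigID (mem s)) [RHS](bigID (mem r)) /=.
rewrite [X in op _ X]big_seq_cond [X in op _ X]big1 ?Monoid.mulm1; last first.
  by move=> x /andP[]; apply: Hr.
rewrite [X in _ = op _ X]big_seq_cond [X in _ = op _ X]big1 ?Monoid.mulm1;
  last by move=> x /andP[]; apply: Hs.
rewrite -big_filter -[RHS]big_filter.
apply/perm_big/uniq_perm; rewrite ?filter_uniq //.
by move=> x; rewrite !mem_filter andbC.
Qed.

(** Vanishing off [r] also supplies the finite support without which the operation over [D] would
    take its default value. *)
Lemma fsbig_seq_support (R : Type) (idx : R) (op : Monoid.com_law idx)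
    (X : choiceType) (D : set X) (r : seq X) (F : X -> R) : uniq r ->
  (forall x, x \in r -> D x) ->
  (forall x, D x -> x \notin r -> F x = idx) ->
  \big[op/idx]_(x \in D) F x = \big[op/idx]_(x <- r) F x.
Proof.
move=> ur rD Dr; rewrite (fsbig_seq _ F ur).
apply/esym/fsbig_widen => [x /rD //|x [/= Dx /negP xr]].
exact: Dr.
Qed.

Section FSeriesCoefs.
Context (M : factMonoidType).

Lemma fs_sumE (R : pzRingType) (X : Type) (r : seq X) (Q : pred X)
    (F : X -> fseries M R) (d : M) :
  (\sum_(x <- r | Q x) F x) d = \sum_(x <- r | Q x) F x d.
Proof. exact: (big_morph (fun f : fseries M R => f d)). Qed.

Lemma fs_mulE (R : pzRingType) (f g : fseries M R) (d : M) :
  (f * g) d = \sum_(p <- fset_set (facts d)) f p.1 * g p.2.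
Proof.
transitivity (\sum_(p \in facts d) f p.1 * g p.2); first by [].
by rewrite fsbig_finite //; exact: fm_finite.
Qed.

Lemma mem_facts (d : M) (p : M * M) :
  (p \in fset_set (facts d)) = (fmM p.1 p.2 == d).
Proof.
rewrite in_fset_set; last exact: fm_finite.
by apply/idP/eqP; rewrite inE.
Qed.

End FSeriesCoefs.

(** A factorisation of [w] amounts to a cut position between 0 and [size w]. *)
Lemma fs_mul_wordE (A : choiceType) (R : pzRingType)
    (f g : fseries (seq A) R) (w : seq A) :
  (f * g) w = \sum_(s < (size w).+1) f (take s w) * g (drop s w).
Proof.
rewrite fs_mulE.
pose F (p : seq A * seq A) := f p.1 * g p.2.
transitivity (\sum_(p <- [seq (take s w, drop s w) | s <- iota 0 (size w).+1])
  F p); last first.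
  rewrite -(big_mkord xpredT (fun s => f (take s w) * g (drop s w))).
  by rewrite big_map /index_iota subn0.
apply/perm_big/uniq_perm; first exact: fset_uniq.
  rewrite map_inj_in_uniq ?iota_uniq // => s t.
  rewrite !mem_iota !add0n !ltnS /= => sw tw [/(congr1 size)].
  by rewrite !size_take_min (minn_idPl sw) (minn_idPl tw).
move=> [u v]; rewrite mem_facts; apply/eqP/mapP => [<-|[s _ [-> ->]]].
  exists (size u); first by rewrite mem_iota /= ltnS size_cat leq_addr.
  by rewrite take_size_cat // drop_size_cat.
exact: cat_take_drop.
Qed.

Section Commutative.
Context (I : choiceType) (K : comPzRingType).

Fact fs_mulC : commutative (@GRing.mul (fseries {mset I} K)).
Proof.
move=> f g; apply/fseriesP => d; rewrite !fs_mulE.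
pose F (p : {mset I} * {mset I}) := g p.1 * f p.2.
transitivity (\sum_(p <- [seq (p.2, p.1) | p <- fset_set (facts d)]) F p).
  by rewrite big_map; apply: eq_bigr => p _; rewrite mulrC.
apply/perm_big/uniq_perm; last 1 first.
- move=> [u v]; rewrite mem_facts; apply/mapP/eqP => /= [[[u' v']]|e].
    by rewrite mem_facts /= => /eqP <- [-> ->]; apply: msetDC.
  by exists (v, u) => //; rewrite mem_facts -e; apply/eqP/msetDC.
- by rewrite map_inj_uniq ?fset_uniq // => -[? ?] [? ?] [-> ->].
- exact: fset_uniq.
Qed.

HB.instance Definition _ :=
  GRing.PzRing_hasCommutativeMul.Build (fseries {mset I} K) fs_mulC.

End Commutative.

Section WordCoef.
Context {A I : choiceType} {K : comPzRingType}.
Local Notation W := (wseries A I K).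
Local Notation Q := (fseries {mset I} K).
Implicit Types (f g c : W) (w v : seq A).

(** Swaps the two layers: a series in the t_k over word series is reread as a word series over the
    commutative ring of power series in the t_k. *)
Definition wcoef w f : Q := FSeries (fun d => f d w).

Lemma wcoefP f g : (forall w, wcoef w f = wcoef w g) -> f = g.
Proof.
move=> fg; apply/fseriesP => d; apply/fseriesP => w.
by have /fseriesP/(_ d) := fg w.
Qed.

Fact wcoef_is_zmod_morphism w : zmod_morphism (wcoef w).
Proof. by move=> f g; apply/fseriesP. Qed.
HB.instance Definition _ w :=
  GRing.isZmodMorphism.Build W Q (wcoef w) (wcoef_is_zmod_morphism w).

Lemma wcoefM w f g :
  wcoef w (f * g) =
  \sum_(s < (size w).+1) wcoef (take s w) f * wcoef (drop s w) g.
Proof.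
apply/fseriesP => d; rewrite fs_sumE.
transitivity ((f * g) d w); first by [].
rewrite fs_mulE fs_sumE.
under eq_bigr do rewrite fs_mul_wordE.
rewrite exchange_big; apply: eq_bigr => s _.
by rewrite fs_mulE.
Qed.

Lemma wcoef_word w v : wcoef w (word v) = (w == v)%:R.
Proof.
apply/fseriesP => d; rewrite /= (fun_if (fun f : fseries _ _ => f w)) /=.
by case: (w == v) => //=; case: ifP.
Qed.

Lemma wcoef1 w : wcoef w 1 = (w == [::])%:R.
Proof. exact: (wcoef_word w [::]). Qed.

(** The empty word has a single cut. As a ring morphism this coefficient passes through the products
    and powers of [wprod]. *)
Fact wcoef0_is_monoid_morphism : monoid_morphism (wcoef [::]).
Proof.
split=> [|f g]; first by rewrite wcoef1.
by rewrite wcoefM /= big_ord1.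
Qed.
HB.instance Definition _ :=
  GRing.isMonoidMorphism.Build W Q (wcoef [::]) wcoef0_is_monoid_morphism.

(* [c] involves no letter, only the indeterminates t_k. *)
Definition wscalar c := forall w, w != [::] -> wcoef w c = 0.

Lemma wscalar1 : wscalar 1.
Proof. by move=> w /negPf w0; rewrite wcoef1 w0. Qed.

Lemma wscalarB c c' : wscalar c -> wscalar c' -> wscalar (c - c').
Proof. by move=> Hc Hc' w w0; rewrite raddfB /= Hc // Hc' // subr0. Qed.

Lemma wscalarD c c' : wscalar c -> wscalar c' -> wscalar (c + c').
Proof. by move=> Hc Hc' w w0; rewrite raddfD /= Hc // Hc' // addr0. Qed.

Lemma wscalarM c c' : wscalar c -> wscalar c' -> wscalar (c * c').
Proof.
move=> Hc Hc' w w0; rewrite wcoefM big1 // => -[[|s] /= sw] _.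
  by rewrite take0 drop0 Hc' // mulr0.
by rewrite Hc ?mul0r //; case: w w0 {sw}.
Qed.

Lemma wscalarX c n : wscalar c -> wscalar (c ^+ n).
Proof.
move=> Hc; elim: n => [|n IH]; first exact: wscalar1.
by rewrite exprS; apply: wscalarM.
Qed.

Lemma wscalar_tvar k : wscalar (tvar k).
Proof.
move=> w /negPf w0; apply/fseriesP => d; rewrite /wcoef /tvar /=.
by case: (d == _) => //=; rewrite w0.
Qed.

Lemma wscalar_wprod (x : I -> W) n :
  (forall k, wscalar (x k)) -> wscalar (wprod x n).
Proof.
move=> xs; rewrite /wprod; elim/big_ind: _ => [||k _].
- exact: wscalar1.
- exact: wscalarM.
- exact: wscalarX.
Qed.

Lemma wscalar_fsbig (X : choiceType) (D : set X) (c : X -> W) :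
  (forall x, wscalar (c x)) -> wscalar (\sum_(x \in D) c x).
Proof.
move=> xs; elim/big_ind: _ => [w _||k _]; last exact: xs.
- exact: raddf0.
- exact: wscalarD.
Qed.

(** Only the cut in front of the word survives, since [c] vanishes on every nonempty prefix. *)
Lemma wcoef_scalar_word w v c : wscalar c ->
  wcoef w (c * word v) = if w == v then wcoef [::] c else 0.
Proof.
move=> cs; rewrite wcoefM big_ord_recl /= take0 drop0 wcoef_word big1 => [|s _].
  by rewrite addr0; case: eqP; rewrite ?mulr1 ?mulr0.
by rewrite /bump /= cs ?mul0r //; case: w s => // -[].
Qed.

Lemma wcoef_word_scalar w v c : wscalar c ->
  wcoef w (word v * c) = if w == v then wcoef [::] c else 0.
Proof.
move=> cs; rewrite wcoefM big_ord_recr /= take_size drop_size wcoef_word.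
rewrite big1 => [|s _].
  by rewrite add0r; case: eqP; rewrite ?mul1r ?mul0r.
by rewrite cs ?mulr0 // -size_eq0 size_drop -lt0n subn_gt0.
Qed.

Lemma wcoef_fsum (X : choiceType) (D : set X) (r : seq X) (f : X -> W) w :
  uniq r -> (forall x, x \in r -> D x) ->
  (forall x, D x -> x \notin r -> wcoef w (f x) = 0) ->
  wcoef w (fsum D f) = \sum_(x <- r) wcoef w (f x).
Proof.
move=> ur rD Dr; apply/fseriesP => d; rewrite fs_sumE /=.
apply: fsbig_seq_support => // x Dx xr.
by have /fseriesP/(_ d) := Dr x Dx xr.
Qed.

Lemma wcoef_wprod (x : I -> W) (n : I -> nat) (r : seq I) : uniq r ->
  (forall k, n k != 0 -> k \in r) ->
  wcoef [::] (wprod x n) = \prod_(k <- r) wcoef [::] (x k) ^+ n k.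
Proof.
move=> ur nr; rewrite /wprod rmorph_prod /=.
under eq_bigr do rewrite rmorphXn /=.
(* Infinitely many factors other than 1 would make [wprod] an empty product; here their indices all
   lie in [r]. *)
have fin : finite_set
    (setT `&` (fun k => x k ^+ n k) @^-1` [set~ 1])%classic.
  apply: (sub_finite_set _ (finite_seq r)) => k [_ /= xk1].
  by apply: nr; apply: contra_not_neq xk1 => ->; rewrite expr0.
apply: big_uniq_support => //.
- move=> k _; rewrite in_finite_support // notin_setE /= => xk1.
  have /contrapT : ~ (x k ^+ n k <> 1) by move=> ?; apply: xk1.
  by move=> /(congr1 (wcoef [::])); rewrite rmorphXn rmorph1.
- move=> k _ kr; have /eqP -> : n k == 0%N by apply: contraNT kr; apply: nr.
  exact: expr0.
Qed.

End WordCoef.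

(** * Walks *)

Section Walks.
Context {A : choiceType} {m : nat} (G : rel 'I_m) (P : 'I_m -> 'I_m -> set A).
Implicit Types (al : seq (@arcletter A m)) (i j k : 'I_m).

Lemma walks_take n al : walks G P al -> walks G P (take n al).
Proof.
case=> alP als; split; last exact: take_sorted.
by move=> p /mem_take; apply: alP.
Qed.

Lemma walks_drop n al : walks G P al -> walks G P (drop n al).
Proof.
case=> alP als; split; last exact: drop_sorted.
by move=> p /mem_drop; apply: alP.
Qed.

Lemma walks_from_to_cons i j p al :
  walks_from_to G P i j (p :: al) <->
  [/\ Pset G P p, p.2.1 = i & walks_from_to G P p.2.2 j al].
Proof.
split=> [[[pP ps] [[<- <-]|[]//]]|[Pp <- [[alP als] e]]].
  split=> //; first by apply: pP; rewrite mem_head.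
  split.
    have wp : walks G P (p :: al) by [].
    by have := walks_drop 1 wp; rewrite /= drop0.
  case: al ps {pP} => [|q al] /=; first by right.
  by case/andP=> /eqP ->; left.
split; last first.
  left; case: e => [|[-> <-]] //.
  by case: al {alP als} => //= q al [_ ->].
split; first by move=> q; rewrite inE => /predU1P[-> //|]; apply: alP.
case: e => [|[-> _] //]; case: al {alP} als => //= q al -> [-> _].
by rewrite eqxx.
Qed.

(** Once the word and the two end vertices are fixed, only the intermediate vertices are free. This
    finiteness gives the infinite sums over walks their coefficients. *)
Fixpoint walk_seq (w : seq A) (i j : 'I_m) : seq (seq (@arcletter A m)) :=
  if w is a :: w' then
    [seq (a, (i, k)) :: al |
      k <- [seq k <- index_enum 'I_m | `[< Pset G P (a, (i, k)) >]],
      al <- walk_seq w' k j]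
  else if i == j then [:: [::]] else [::].

Lemma walk_seqP w i j al :
  reflect (walks_from_to G P i j al /\ rho al = w) (al \in walk_seq w i j).
Proof.
elim: w i j al => [|a w IH] i j al /=.
  apply: (iffP idP) => [|[[_ e] re]]; last first.
    have al0 : al = [::] by case: al re {e}.
    by case: e => [|[_ ->]]; rewrite al0 // eqxx mem_seq1.
  case: eqP => // <-; rewrite mem_seq1 => /eqP ->.
  by split=> //; split; [split|right].
apply: (iffP allpairsPdep) => [[k [al' [kP wal' ->]]]|].
  move: kP wal'; rewrite mem_filter => /andP[/asboolP Pk _] /IH[wal' <-].
  by split=> //; apply/walks_from_to_cons.
case: al => [[]//|[b [i' k]] al] [/walks_from_to_cons[/= Pp ei wal] [eb ew]].
rewrite {}ei {}eb in Pp *; exists k, al; split=> //; last exact/IH.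
by rewrite mem_filter mem_index_enum andbT; apply/asboolP.
Qed.

Lemma walk_seq_uniq w i j : uniq (walk_seq w i j).
Proof.
elim: w i j => [|a w IH] i j /=; first by case: eqP.
apply: allpairs_uniq_dep => // [|[k al] [k' al'] _ _ /= [-> ->] //].
by rewrite filter_uniq // index_enum_uniq.
Qed.

(** A walk splits uniquely at the vertex [k] reached after reading [w]; this vertex becomes the
    inner index of a matrix product. *)
Lemma big_walk_seq_cat (R : nmodType) (f : seq arcletter -> R) w v i j :
  \sum_(al <- walk_seq (w ++ v) i j) f al =
  \sum_k \sum_(al <- walk_seq w i k) \sum_(ga <- walk_seq v k j) f (al ++ ga).
Proof.
elim: w i f => [|a w IH] i f /=.
  rewrite (bigD1 i) //= eqxx big_seq1 /= [X in _ + X]big1 ?addr0 // => k /negPf ki.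
  by rewrite eq_sym ki big_nil.
rewrite big_allpairs_dep /=.
under eq_bigr do rewrite IH.
rewrite exchange_big; apply: eq_bigr => k _ /=.
by rewrite big_allpairs_dep.
Qed.

End Walks.

(** * Marks and cuts *)

(** Expanding the product means choosing 1 or [y q] in each factor; [S] records where [y q] is
    chosen. *)
Lemma big_fpowerset_distr (R : comPzRingType) (X : choiceType) (D : {fset X})
    (y : X -> R) :
  \prod_(q <- D) (1 + y q) = \sum_(S <- fpowerset D) \prod_(q <- S) y q.
Proof.
elim/fset1U_rect: D => [|a D aD IH].
  by rewrite fpowerset0 !big_seq_fset1 !big_seq_fset0.
(* The subsets of the enlarged set: those without [a], then those with it. *)
pose s : seq {fset X} :=
  fpowerset D ++ [seq (a |` B)%fset | B <- fpowerset D].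
have aN S : S \in fpowerset D -> a \notin S.
  by rewrite fpowersetE => /fsubsetP SD; apply: contra aD => /SD.
rewrite big_fsetU1 //= IH mulrDl mul1r.
transitivity (\sum_(S <- s) \prod_(q <- S) y q).
  rewrite big_cat big_map /=; congr (_ + _).
  rewrite mulr_sumr big_seq [RHS]big_seq.
  by apply: eq_bigr => S /aN aS; rewrite big_fsetU1.
apply/perm_big/uniq_perm; last first.
- move=> S; rewrite mem_cat !fpowersetE; apply/orP/idP => [[|/mapP[S' + ->]]|].
  + by move=> /fsubset_trans; apply; apply: fsubsetU1.
  + by rewrite fpowersetE => /(fsetUS [fset a]%fset).
  + move=> SD; have [aS|aS] := boolP (a \in S); [right|left].
      apply/mapP; exists (S `\ a)%fset; last by rewrite fsetD1K.
      by rewrite fpowersetE fsubDset.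
    apply/fsubsetP => q qS.
    move/fsubsetP/(_ q qS): SD; rewrite !inE => /predU1P[qa|//].
    by rewrite -qa qS in aS.
- exact: fset_uniq.
rewrite cat_uniq fset_uniq /=; apply/andP; split.
  by apply/hasPn => _ /mapP[S _ ->]; apply/negP => /aN; rewrite fset1U1.
rewrite map_inj_in_uniq ?fset_uniq // => S S' /aN aS /aN aS' e.
by rewrite -(fsetU1K aS) e fsetU1K.
Qed.

Section Marks.
Context {A I : choiceType} {m : nat} (G : rel 'I_m).
Context (P : 'I_m -> 'I_m -> set A) (beta : I -> seq A).
Hypothesis beta_inj : injective beta.
Hypothesis beta_size : forall k, (2 <= size (beta k))%N.
Local Notation letter := (@arcletter A m).
Local Notation mrk := (nat * seq letter)%type.
Implicit Types (al ga : seq letter) (S : {fset mrk}) (q : mrk) (s t n : nat).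

Lemma Barrow_size u ga : Barrow G P beta u ga -> (2 <= size ga)%N.
Proof. by case=> _ e; rewrite -(size_map fst ga) -/(rho ga) e. Qed.

(** A marked subword is determined by its position and length, so a finite list of candidates
    suffices. *)
Definition marks al : {fset mrk} :=
  [fset q in [seq (n, take l (drop n al)) |
      n <- iota 0 (size al), l <- iota 0 (size al).+1] |
    `[< exists u, Barrow G P beta u q.2 >]]%fset.

Lemma marksP al q :
  reflect (marked_subword G P beta al q) (q \in marks al).
Proof.
rewrite !inE; apply: (iffP andP) => [[/allpairsPdep[n [l [_ _ ->]]]]|].
  by move=> /asboolP qB; split=> //; apply: prefix_take.
case: q => n ga [[u uB] pre]; split; last by apply/asboolP; exists u.
apply/allpairsPdep; exists n, (size ga).
have /size_prefix := pre; rewrite size_drop => gal.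
have ga2 := Barrow_size uB.
rewrite !mem_iota !add0n !leq0n !andTb ltnS; split.
- by rewrite -subn_gt0; apply: leq_trans gal; apply: leq_trans ga2.
- by apply: leq_trans gal _; apply: leq_subr.
- by move: pre; rewrite prefixE /= => /eqP ->.
Qed.

Lemma mem_marks_size al q : q \in marks al ->
  (2 <= size q.2)%N /\ (q.1 + size q.2 <= size al)%N.
Proof.
move=> /marksP[[u uB] /size_prefix]; rewrite size_drop => qal.
have q2 := Barrow_size uB; split=> //.
by rewrite -leq_subRL // ltnW // -subn_gt0 (leq_trans _ qal) // (leq_trans _ q2).
Qed.

Lemma marks_nil : marks [::] = fset0.
Proof.
apply/fsetP => q; rewrite inE; apply/negP => /mem_marks_size[q2].
by rewrite leqn0 addn_eq0 => /andP[_ /eqP q0]; rewrite q0 in q2.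
Qed.

Lemma mem_marks_take al s q :
  (q \in marks (take s al)) = (q \in marks al) && (q.1 + size q.2 <= s)%N.
Proof.
apply/idP/andP => [qs|[/marksP[qB pre] qs]].
  have [_ ] := mem_marks_size qs; rewrite size_take_min leq_min => /andP[le_s _].
  split=> //; move: qs => /marksP[qB pre]; apply/marksP; split=> //.
  have sq : (q.1 <= s)%N by apply: leq_trans le_s; apply: leq_addr.
  move: pre; rewrite -[in take s al](subnK sq) -take_drop !prefixE.
  by rewrite take_takel // leq_subRL.
apply/marksP; split=> //.
have sq : (q.1 <= s)%N by apply: leq_trans qs; apply: leq_addr.
move: pre; rewrite -[in take s al](subnK sq) -take_drop !prefixE.
by rewrite take_takel // leq_subRL.
Qed.

Lemma mem_marks_drop al s q :
  (q \in marks (drop s al)) = ((q.1 + s, q.2)%N \in marks al).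
Proof.
by apply/marksP/marksP => -[qB pre]; split=> //; move: pre; rewrite drop_drop.
Qed.

(* No mark of [S] straddles position [s]. *)
Definition cut s S := all (fun q => (q.1 + size q.2 <= s) || (s <= q.1))%N S.

(** Position 0 is left out because every set of marks is cut there; for positive [s] the list holds
    the positions strictly between 0 and [s]. *)
Definition first_cut s S := cut s S && all (fun t => ~~ cut t S) (iota 1 s.-1).

Lemma cutP s S :
  reflect {in S, forall q, (q.1 + size q.2 <= s) || (s <= q.1)}%N (cut s S).
Proof. exact: allP. Qed.

Lemma first_cutP s S :
  reflect (cut s S /\ forall t, (0 < t < s)%N -> ~~ cut t S) (first_cut s S).
Proof.
apply: (iffP andP) => -[cs Hs]; split=> //.
  move=> t /andP[t0 ts]; apply: (allP Hs); rewrite mem_iota t0 /=.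
  by rewrite add1n prednK // (leq_trans _ ts).
apply/allP => t; rewrite mem_iota => /andP[t0 ts]; apply: Hs.
by move: ts; rewrite t0; case: (s) => //; rewrite ltnNge t0.
Qed.

(** Splitting at [s] sends marks to [lo] or [hi] by their starting position; [shift] undoes the
    renumbering in [hi]. The filter in [hi] precedes the subtraction, so nothing is truncated. *)
Definition shift s S : {fset mrk} :=
  [fset ((q.1 + s)%N, q.2) | q : mrk in S]%fset.
Definition lo s S : {fset mrk} := [fset q in S | (q.1 < s)%N]%fset.
Definition hi s S : {fset mrk} :=
  [fset ((q.1 - s)%N, q.2) | q in [fset q in S | (s <= q.1)%N]]%fset.

Lemma in_lo s S q : (q \in lo s S) = (q \in S) && (q.1 < s)%N.
Proof. by rewrite !inE. Qed.

Lemma in_hi s S q : (q \in hi s S) = ((q.1 + s, q.2)%N \in S).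
Proof.
apply/imfsetP/idP => [[[n ga]]|qS] /=.
  by rewrite !inE /= => /andP[nS sn] -> /=; rewrite subnK.
exists (q.1 + s, q.2)%N; last by rewrite /= addnK -surjective_pairing.
by rewrite !inE /= qS leq_addl.
Qed.

Lemma in_shift s S q :
  (q \in shift s S) = (s <= q.1)%N && ((q.1 - s, q.2)%N \in S).
Proof.
apply/imfsetP/andP => [[[n ga] /= nS ->]|[sq qS]] /=.
  by rewrite leq_addl addnK.
by exists (q.1 - s, q.2)%N => //=; rewrite subnK // -surjective_pairing.
Qed.

Lemma lo_shift_hi s S : S = (lo s S `|` shift s (hi s S))%fset.
Proof.
apply/fsetP => -[n ga]; rewrite inE in_lo in_shift in_hi /=.
by case: (leqP s n) => [/subnK -> |_]; rewrite ?andbF ?andbT ?orbF.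
Qed.

(** The cut forces a mark that starts before [s] to end by [s]. *)
Lemma sub_marks_lo al s S : (S `<=` marks al)%fset -> cut s S ->
  (lo s S `<=` marks (take s al))%fset.
Proof.
move=> /fsubsetP SM /cutP cS; apply/fsubsetP => q.
rewrite in_lo mem_marks_take => /andP[qS qs]; rewrite SM //=.
by have := cS q qS; rewrite leqNgt [X in _ || X]leqNgt qs orbF -leqNgt.
Qed.

Lemma sub_marks_hi al s S : (S `<=` marks al)%fset ->
  (hi s S `<=` marks (drop s al))%fset.
Proof.
move=> /fsubsetP SM; apply/fsubsetP => q.
by rewrite in_hi mem_marks_drop; apply: SM.
Qed.

(** * Gluing the marks of a prefix and of a suffix *)

Section Cat.
Context (al : seq letter) (s : nat) (S1 S2 : {fset mrk}).
Hypotheses (SM1 : (S1 `<=` marks (take s al))%fset).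
Hypotheses (SM2 : (S2 `<=` marks (drop s al))%fset).
Let S := (S1 `|` shift s S2)%fset.

Let S1_end q : q \in S1 -> (q.1 + size q.2 <= s)%N /\ (q.1 < s)%N.
Proof.
move=> qS; have qM := fsubsetP SM1 q qS.
have [q2 _] := mem_marks_size qM.
move: qM; rewrite mem_marks_take => /andP[_ qs]; split=> //.
by apply: leq_trans qs; rewrite -addn1 leq_add2l ltnW.
Qed.

Lemma sub_marks_cat : (S `<=` marks al)%fset.
Proof.
apply/fsubsetP => q; rewrite inE in_shift => /orP[qS|/andP[sq qS]].
  by move/fsubsetP: SM1 => /(_ q qS); rewrite mem_marks_take => /andP[].
move/fsubsetP: SM2 => /(_ _ qS); rewrite mem_marks_drop /= subnK //.
by rewrite -surjective_pairing.
Qed.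

Lemma cut_cat : cut s S.
Proof.
apply/cutP => q; rewrite inE in_shift => /orP[/S1_end[-> //]|/andP[-> _]].
by rewrite orbT.
Qed.

Lemma cut_cat_lt t : (t < s)%N -> cut t S = cut t S1.
Proof.
move=> ts; apply/cutP/cutP => H q qS; first by apply: H; rewrite inE qS.
move: qS; rewrite inE in_shift => /orP[/H //|/andP[sq _]].
by rewrite (leq_trans (ltnW ts) sq) orbT.
Qed.

(** The seam [s] cuts both sets, and marks of the suffix cannot straddle an earlier position. *)
Lemma first_cut_cat : first_cut s S = first_cut s S1.
Proof.
have cS1 : cut s S1 by apply/cutP => q /S1_end[->].
apply/first_cutP/first_cutP => -[_ H]; split; rewrite ?cut_cat // => t ts.
  by rewrite -cut_cat_lt ?H //; case/andP: ts.
by rewrite cut_cat_lt ?H //; case/andP: ts.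
Qed.

Lemma lo_cat : lo s S = S1.
Proof.
apply/fsetP => q; rewrite in_lo inE in_shift.
have [qS|_] /= := boolP (q \in S1); first by case: (S1_end qS).
by case: leqP; rewrite ?andbF.
Qed.

Lemma hi_cat : hi s S = S2.
Proof.
apply/fsetP => q; rewrite in_hi inE in_shift /= leq_addl addnK.
rewrite -surjective_pairing; case: (q \in S2); rewrite ?orbT // orbF.
by apply/negP => /S1_end[_ /=]; rewrite ltnNge leq_addl.
Qed.

(** The weight of a mark ignores its position, so it is invariant under [shift]. *)
Lemma big_marks_cat (R : comPzRingType) (y : seq letter -> R) :
  \prod_(q <- S) y q.2 = (\prod_(q <- S1) y q.2) * \prod_(q <- S2) y q.2.
Proof.
rewrite (big_fsetID _ (fun q => (q.1 < s)%N)) /= -/(lo s S) lo_cat.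
congr (_ * _); rewrite -[S2]hi_cat /hi [RHS]big_imfset /=; last first.
  move=> [n ga] [n' ga']; rewrite !inE /= => /andP[_ sn] /andP[_ sn'] [e ->].
  by rewrite -(subnK sn) e subnK.
by apply: eq_fbigl => q; rewrite !inE /= -leqNgt.
Qed.

End Cat.

(** * Weights of marked walks and their factorisation at the first cut *)

Section Weights.
Context (R : comPzRingType) (y : seq letter -> R).

Definition marked_weight al : R :=
  \sum_(S <- fpowerset (marks al)) \prod_(q <- S) y q.2.

(* Weight of the marked words on [al] that are not proper concatenations. *)
Definition irreducible_weight al : R :=
  if al is [::] then 0 else
  \sum_(S <- fpowerset (marks al) | first_cut (size al) S) \prod_(q <- S) y q.2.

(** Sets of marks with first cut [s] correspond bijectively to pairs of sets on the prefix and on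
    the suffix, the first-cut condition bearing on the prefix alone. *)
Lemma big_first_cut al s :
  \sum_(S <- fpowerset (marks al) | first_cut s S) \prod_(q <- S) y q.2 =
  (\sum_(S <- fpowerset (marks (take s al)) | first_cut s S)
    \prod_(q <- S) y q.2) * marked_weight (drop s al).
Proof.
set M1 := fpowerset (marks (take s al)); set M2 := fpowerset (marks (drop s al)).
have sub1 B : B \in [seq B <- M1 | first_cut s B] ->
    (B `<=` marks (take s al))%fset.
  by rewrite mem_filter fpowersetE => /andP[].
have sub2 B : B \in M2 -> (B `<=` marks (drop s al))%fset.
  by rewrite fpowersetE.
rewrite -big_filter -[X in _ = X * _]big_filter big_distrlr /=.
transitivity (\sum_(B <- [seq (B1 `|` shift s B2)%fset |
    B1 <- [seq B <- M1 | first_cut s B], B2 <- M2]) \prod_(q <- B) y q.2);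
    last first.
  rewrite big_allpairs_dep big_seq [RHS]big_seq; apply: eq_bigr => B1 /sub1 h1.
  by apply: eq_bigr => B2 _; rewrite (big_marks_cat _ h1).
apply/perm_big/uniq_perm; first by rewrite filter_uniq ?fset_uniq.
  apply: allpairs_uniq_dep; first by rewrite filter_uniq ?fset_uniq.
    by move=> B _; rewrite fset_uniq.
  move=> u1 u2 /allpairsPdep[B1 [B2 [/sub1 h1 /sub2 h2 ->]]].
  move=> /allpairsPdep[C1 [C2 [/sub1 k1 /sub2 k2 ->]]] /= e.
  (* Both components are recovered from the glued set, whence injectivity. *)
  have := congr1 (lo s) e; have := congr1 (hi s) e.
  by rewrite (lo_cat _ h1) (lo_cat _ k1) (hi_cat _ h1) (hi_cat _ k1) => -> ->.
move=> B; rewrite mem_filter fpowersetE.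
apply/andP/allpairsPdep => [[fB BM]|[B1 [B2 [B1M /sub2 h2 ->]]]].
  have cB : cut s B by case/andP: fB.
  have h1 := sub_marks_lo BM cB; have h2 := sub_marks_hi s BM.
  exists (lo s B), (hi s B); split; last exact: lo_shift_hi.
    by rewrite mem_filter fpowersetE h1 andbT -(first_cut_cat (hi s B) h1) //
      -lo_shift_hi.
  by rewrite fpowersetE.
have h1 := sub1 _ B1M; move: B1M; rewrite mem_filter => /andP[fB1 _].
by rewrite (first_cut_cat _ h1) (sub_marks_cat h1 h2).
Qed.

(** The end of the walk is always a cut, so there is a least positive one. It is stored as its
    predecessor, an ordinal below [size al]. *)
Lemma ex_first_cut al S : al != [::] -> (S `<=` marks al)%fset ->
  exists s : 'I_(size al), forall t : 'I_(size al),
    first_cut t.+1 S = (t == s).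
Proof.
rewrite -size_eq0 -lt0n => al0 /fsubsetP SM.
have cal : cut (size al) S.
  by apply/cutP => q /SM/mem_marks_size[_ ->].
have exs : exists s, (0 < s)%N && cut s S.
  by exists (size al); rewrite al0.
case: (ex_minnP exs) => -[//|s] /= cs mins.
have sal : (s < size al)%N by apply: mins; rewrite al0.
exists (Ordinal sal) => t; apply/first_cutP/eqP => [[ct mint]|->].
  have st : (s <= t)%N by have := mins t.+1; rewrite ct; apply.
  apply/val_inj/eqP; rewrite eqn_leq st andbT leqNgt; apply/negP => ts.
  by have := mint s.+1; rewrite /= ltnS ts cs => /(_ isT).
split=> // t' /andP[t'0 t's]; apply/negP => ct'.
by have := mins t'; rewrite t'0 ct' => /(_ isT); rewrite leqNgt t's.
Qed.

(** The sets of marks are grouped by their first positive cut. *)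
Lemma marked_weight_rec al : al != [::] ->
  marked_weight al = \sum_(s < size al)
    irreducible_weight (take s.+1 al) * marked_weight (drop s.+1 al).
Proof.
move=> al0.
transitivity (\sum_(s < size al) \sum_(S <- fpowerset (marks al) |
    first_cut s.+1 S) \prod_(q <- S) y q.2).
  under eq_bigr do rewrite big_mkcond.
  rewrite exchange_big /=; apply: eq_big_seq => S.
  rewrite fpowersetE => /(ex_first_cut al0)[s fs].
  by rewrite -big_mkcond /= (eq_bigl _ _ fs) big_pred1_eq.
apply: eq_bigr => s _; rewrite big_first_cut; congr (_ * _).
have := size_takel (ltn_ord s); rewrite /irreducible_weight.
by case: (take _ _) => //= a l ->.
Qed.

(** An empty set of marks is cut everywhere, so it is irreducible only on a single letter, where it
    has weight 1. *)
Lemma irreducible_weightE al :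
  irreducible_weight al = (size al == 1)%:R +
  \sum_(S <- fpowerset (marks al) | (S != fset0) && first_cut (size al) S)
    \prod_(q <- S) y q.2.
Proof.
have [->|al0] := eqVneq al [::].
  by rewrite marks_nil fpowerset0 add0r big_mkcond big_seq_fset1 eqxx.
transitivity (\sum_(S <- fpowerset (marks al) | first_cut (size al) S)
    \prod_(q <- S) y q.2); first by case: (al) al0.
rewrite (bigID (pred1 fset0)) /=; congr (_ + _); last first.
  by apply: eq_bigl => S; rewrite andbC.
have -> : (size al == 1)%N = first_cut (size al) fset0.
  apply/eqP/first_cutP => [->|[_ H]].
    by split=> [|[|[]]//]; apply/cutP.
  have : (0 < size al)%N by rewrite lt0n size_eq0.
  rewrite leq_eqVlt => /predU1P[//|al1].
  by have := H 1%N al1; case: cutP => //; case.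
rewrite big_mkcond (bigD1_seq fset0) ?fset_uniq ?fpowersetE ?fsub0set //=.
rewrite eqxx andbT big_seq_fset0 big1 => [|S /negPf ->].
  by rewrite addr0; case: ifP.
by rewrite andbF.
Qed.

End Weights.

(** * Clusters as irreducible sets of marks *)

Lemma marked_wordE al S : walks G P al ->
  marked_word G P beta (al, S) <-> (S `<=` marks al)%fset.
Proof.
case=> alP _; split=> [[_ H]|/fsubsetP H].
  by apply/fsubsetP => q /H /marksP.
by split=> // q /H /marksP.
Qed.

(** An interior cut yields a proper concatenation through [lo] and [hi]; conversely the seam of a
    proper concatenation is an interior cut. *)
Lemma clusterE al S : walks G P al -> (S `<=` marks al)%fset ->
  cluster G P beta (al, S) <-> (S != fset0) && first_cut (size al) S.
Proof.
move=> wal SM; split=> [[_ S0 irr]|/andP[S0 /first_cutP[_ fS]]].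
  rewrite S0; apply/first_cutP; split=> [|t /andP[t0 tal]].
    by apply/cutP => q /(fsubsetP SM)/mem_marks_size[_ ->].
  apply/negP => ct; apply: irr.
  exists (take t al, lo t S), (drop t al, hi t S); split.
  - by apply/marked_wordE; [exact: walks_take|exact: sub_marks_lo].
  - by apply/marked_wordE; [exact: walks_drop|exact: sub_marks_hi].
  - by rewrite -size_eq0 size_takel ?(ltnW tal) // -lt0n.
  - by rewrite -size_eq0 size_drop -lt0n subn_gt0.
  - rewrite /mword_cat /= cat_take_drop size_takel ?(ltnW tal) //.
    by rewrite {1}(lo_shift_hi t S).
split=> // [|[[al1 S1] [[al2 S2] [m1 m2 al10 al20]]]]; first exact/marked_wordE.
move=> [eal eS].
have w1 : walks G P al1.
  by have := walks_take (size al1) wal; rewrite eal take_size_cat.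
have h1 : (S1 `<=` marks (take (size al1) al))%fset.
  by rewrite eal take_size_cat //; apply/marked_wordE.
have := fS (size al1); rewrite lt0n size_eq0 al10 eal size_cat -[X in (X < _)%N]addn0.
rewrite ltn_add2l lt0n size_eq0 al20 => /(_ isT) /negP; apply.
by rewrite eS; apply: (cut_cat S2 h1).
Qed.

Lemma big_clusters_on (R : nmodType) al (f : mword -> R) : walks G P al ->
  \sum_(c \in clusters_on G P beta al) f c =
  \sum_(S <- fpowerset (marks al) | (S != fset0) && first_cut (size al) S)
    f (al, S).
Proof.
move=> wal; rewrite -[RHS]big_filter.
set r := filter _ _.
transitivity (\sum_(c <- [seq (al, B) | B <- r]) f c); last by rewrite big_map.
apply: fsbig_seq_support.
- by rewrite map_inj_uniq ?filter_uniq ?fset_uniq // => ? ? [].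
- move=> _ /mapP[S + ->]; rewrite mem_filter fpowersetE => /andP[Sc SM].
  by split=> //; apply/clusterE.
move=> [al' S] [/= -> cS] /negP[]; apply/mapP; exists S => //.
have SM : (S `<=` marks al)%fset by apply/(marked_wordE _ wal); case: cS.
by rewrite mem_filter fpowersetE SM andbT; apply/(clusterE wal SM).
Qed.

(** * Coefficients of the matrices *)

(** Since [beta] is injective, the chosen index is the only possible one. *)
Definition mark_index ga : option I :=
  if pselect (exists u, Barrow G P beta u ga) is left exu
  then Some (sval (cid exu)) else None.

Lemma mark_indexP u ga :
  reflect (Barrow G P beta u ga) (mark_index ga == Some u).
Proof.
rewrite /mark_index; case: pselect => [exu|nex]; last first.
  by apply: (iffP idP) => // uB; case: nex; exists u.
case: (cid exu) => v /= [wga vga]; apply: (iffP eqP) => [[<-] //|[_ uga]].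
by congr Some; apply: beta_inj; rewrite -vga uga.
Qed.

Lemma mkE u al S :
  mk G P beta u (al, S) = count (fun q => mark_index q.2 == Some u) S.
Proof.
rewrite /mk card_fset_sum1 big_fset /= sum1_count.
by apply: eq_count => q /=; apply/asboolP/mark_indexP.
Qed.

Lemma mark_index_marks al q : q \in marks al -> exists u, mark_index q.2 = Some u.
Proof. by move=> /marksP[[u /mark_indexP/eqP e] _]; exists u. Qed.

Context {K : comPzRingType}.
Local Notation W := (wseries A I K).

(** The value 1 is a default: every element of [marks] has an index. *)
Definition mark_weight (x : I -> W) ga : fseries {mset I} K :=
  if mark_index ga is Some u then wcoef [::] (x u) else 1.

Lemma wcoef_wprod_mk (x : I -> W) al S : (S `<=` marks al)%fset ->
  wcoef [::] (wprod x (mk G P beta ^~ (al, S))) =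
  \prod_(q <- S) mark_weight x q.2.
Proof.
move=> /fsubsetP SM.
pose r := undup (pmap (fun q => mark_index q.2) S).
have rP q u : q \in S -> mark_index q.2 = Some u -> u \in r.
  move=> qS qu; rewrite mem_undup mem_pmap -qu.
  by apply: (map_f (fun q : mrk => mark_index q.2)).
rewrite (wcoef_wprod _ (undup_uniq _ : uniq r)); last first.
  move=> u; rewrite mkE -lt0n -has_count => /hasP[q qS /eqP qu].
  exact: rP qu.
(* Each exponent becomes a sum of indicators over the marks, so the products over indices and over
   marks can be exchanged. *)
under eq_bigr do rewrite mkE -sum1_count big_mkcond expr_sum.
rewrite exchange_big /=; apply: eq_big_seq => q qS.
have [u qu] := mark_index_marks (SM q qS).
rewrite /mark_weight qu (bigD1_seq u) ?undup_uniq ?(rP q) //= eqxx expr1.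
rewrite big1 ?mulr1 // => v vu.
by case: eqP => // -[uv]; rewrite uv eqxx in vu.
Qed.

(** An occurrence of [beta u] at position [n] of the label lies under exactly one factor of the
    walk, the one of the same length starting at [n]. *)
Lemma bad_marks u al : walks G P al ->
  bad (beta u) (rho al) = mk G P beta u (al, marks al).
Proof.
move=> wal; rewrite mkE /bad -!size_filter size_map.
pose h n := (n, take (size (beta u)) (drop n al)).
rewrite -(size_map h); apply/perm_size/uniq_perm.
- by rewrite map_inj_uniq ?filter_uniq ?iota_uniq // => ? ? [].
- by rewrite filter_uniq ?fset_uniq.
move=> q; rewrite mem_filter; apply/mapP/andP => [[n]|].
  rewrite mem_filter prefixE -map_drop -map_take => /andP[/eqP pre nal] ->.
  have uB : Barrow G P beta u (h n).2.
    by split=> //; apply/walks_take/walks_drop.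
  split; first exact/mark_indexP.
  by apply/marksP; split; [exists u|apply: prefix_take].
case: q => n ga [/mark_indexP[wga uga] nM].
have [_ nal] := mem_marks_size nM.
have us : size (beta u) = size ga by rewrite -uga size_map.
have /marksP[_] := nM; rewrite prefixE => /eqP pre; rewrite /= in nal pre.
exists n; last by rewrite /h us pre.
rewrite mem_filter mem_iota add0n ltnS (leq_trans _ nal) ?leq_addr // !andbT.
by rewrite prefixE -map_drop us -map_take pre -uga.
Qed.

(** The weight is a product of one t_u per mark; writing t_u as 1 + (t_u - 1) and expanding gives a
    sum over sets of marks. *)
Lemma wcoef_wprod_bad al : walks G P al ->
  wcoef [::] (@wprod A I K tvar (fun k => bad (beta k) (rho al))) =
  marked_weight (mark_weight (fun k => tvar k - 1 : W)) al.
Proof.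
move=> wal.
have -> : (fun k => bad (beta k) (rho al)) = mk G P beta ^~ (al, marks al).
  by apply/funext => k; apply: bad_marks.
rewrite wcoef_wprod_mk // /marked_weight.
rewrite -(big_fpowerset_distr (marks al)
  (fun q => mark_weight (fun k => tvar k - 1 : W) q.2)).
apply: eq_big_seq => q /mark_index_marks[u qu].
(* [tvar u] is generalised so that rewriting does not try to unify it with 1. *)
rewrite /mark_weight qu; move: (tvar u) => t.
by rewrite rmorphB rmorph1 addrC subrK.
Qed.

Lemma wcoef_clusters al (x : I -> W) : walks G P al ->
  (size al == 1)%:R +
    wcoef [::] (\sum_(c \in clusters_on G P beta al) wprod x (mk G P beta ^~ c)) =
  irreducible_weight (mark_weight x) al.
Proof.
move=> wal; rewrite irreducible_weightE; congr (_ + _).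
rewrite big_clusters_on // raddf_sum /= big_seq_cond [RHS]big_seq_cond.
apply: eq_bigr => S; rewrite fpowersetE => /andP[SM _].
exact: wcoef_wprod_mk.
Qed.

Local Notation x := (fun k => tvar k - 1 : W).
Local Notation F := (walk_gf G P K beta).
Local Notation N := (@mxfsum A I K m _ (Pset G P) (Mletter K)).
Local Notation L := (cluster_mx G P beta x).

Lemma wscalar_shift k : wscalar (tvar k - 1 : W).
Proof. by apply: wscalarB; [exact: wscalar_tvar|exact: wscalar1]. Qed.

Lemma wcoef_walk_gf w i j :
  wcoef w (F i j) =
  \sum_(al <- walk_seq G P w i j) marked_weight (mark_weight x) al.
Proof.
have sc al : wscalar (wprod tvar (fun k => bad (beta k) (rho al)) : W).
  exact/wscalar_wprod/wscalar_tvar.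
rewrite mxE (@wcoef_fsum _ _ _ _ _ (walk_seq G P w i j)).
- apply: eq_big_seq => al /walk_seqP[[wal _] <-].
  by rewrite wcoef_word_scalar // eqxx; apply: wcoef_wprod_bad.
- exact: walk_seq_uniq.
- by move=> al /walk_seqP[].
- move=> al wal nw; rewrite wcoef_word_scalar //.
  by case: eqP => // e; case/negP: nw; apply/walk_seqP.
Qed.

(** Treating letters as walks of length one puts this sum on the same index list as the cluster
    sum. *)
Lemma wcoef_letter_mx w i j :
  wcoef w (N i j) = \sum_(al <- walk_seq G P w i j) (size al == 1)%:R.
Proof.
have cN p : wcoef w (Mletter K p i j : W) =
    ((p.2 == (i, j)) && (w == [:: p.1]))%:R.
  by rewrite mxE; case: eqP => _; rewrite ?wcoef_word ?raddf0.
rewrite mxE; have [w1|w1] := eqVneq (size w) 1%N; last first.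
  rewrite (@wcoef_fsum _ _ _ _ _ [::]) //.
    rewrite big_nil big1_seq // => al /andP[_ /walk_seqP[_ rw]].
    by rewrite -rw size_map in w1; rewrite (negPf w1).
  move=> p _ _; rewrite cN; case: eqP => //= _.
  by case: eqP => // wp; rewrite wp in w1.
case: w w1 cN => [//|a [|//]] _ cN.
(* For the one-letter word [a] only this letter can contribute, provided that it belongs to the
   network. *)
pose r := [seq p <- [:: (a, (i, j))] | `[< Pset G P p >]].
rewrite (@wcoef_fsum _ _ _ _ _ r); last first.
- move=> [b e] bP; rewrite mem_filter mem_seq1 cN /= => /negP nbr.
  case: eqP => //= e'; case: eqP => //= -[ab]; case: nbr.
  by rewrite ab -e' eqxx andbT; apply/asboolP.
- by move=> p; rewrite mem_filter => /andP[/asboolP].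
- exact: filter_uniq.
under eq_bigr do rewrite cN.
rewrite big_filter big_mkcond big_seq1 /= !eqxx.
rewrite big_allpairs_dep big_filter big_mkcond /= (bigD1 j) //= eqxx big_seq1.
rewrite [X in _ = _ + X]big1 ?addr0 // => k /negPf ->.
by rewrite big_nil; case: ifP.
Qed.

Lemma wcoef_cluster_mx w i j :
  wcoef w (L i j) = \sum_(al <- walk_seq G P w i j)
    wcoef [::] (\sum_(c \in clusters_on G P beta al) wprod x (mk G P beta ^~ c)).
Proof.
have sc al : wscalar
    (\sum_(c \in clusters_on G P beta al) wprod x (mk G P beta ^~ c)).
  by apply: wscalar_fsbig => c; apply/wscalar_wprod/wscalar_shift.
rewrite mxE (@wcoef_fsum _ _ _ _ _ (walk_seq G P w i j)).
- apply: eq_big_seq => al /walk_seqP[[wal e] rw]; rewrite !mxE.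
  case: e => [->|[al0 _]]; first by rewrite eqxx wcoef_scalar_word // rw eqxx.
  (* On the empty walk [Mwalk] is 0, and there is no cluster either, so both sides vanish. *)
  rewrite al0 mulr0 raddf0 big_clusters_on // marks_nil fpowerset0.
  by rewrite big_mkcond big_seq_fset1 eqxx raddf0.
- exact: walk_seq_uniq.
- by move=> al /walk_seqP[[]].
- move=> al wal nw; rewrite !mxE; case: eqP => [e|]; last first.
    by rewrite mulr0 raddf0.
  rewrite wcoef_scalar_word //; case: eqP => // rw; case/negP: nw.
  by apply/walk_seqP; split=> //; split=> //; left.
Qed.

Lemma wcoef_step w i j :
  wcoef w ((N + L) i j) =
  \sum_(al <- walk_seq G P w i j) irreducible_weight (mark_weight x) al.
Proof.
rewrite mxE raddfD /= wcoef_letter_mx wcoef_cluster_mx -big_split /=.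
by apply: eq_big_seq => al /walk_seqP[[wal _] _]; rewrite wcoef_clusters.
Qed.

Lemma wcoef_step_nil i j : wcoef [::] ((N + L) i j) = 0.
Proof.
rewrite wcoef_step big1_seq // => al /andP[_ /walk_seqP[_ /eqP]].
by rewrite -size_eq0 size_map size_eq0 => /eqP ->.
Qed.

Lemma walk_gf_rec : F = 1%:M + (N + L) *m F.
Proof.
apply/matrixP => i j; apply: wcoefP => w.
rewrite wcoef_walk_gf [in RHS]mxE raddfD /= [1%:M _ _]mxE [(_ *m _) _ _]mxE.
rewrite raddf_sum /=; under [X in _ + X]eq_bigr do rewrite wcoefM.
(* The cut at 0 drops out because the step matrix has no term in the empty word. *)
rewrite exchange_big /= big_ord_recl [X in _ + (X + _)]big1 => [|k _]; last first.
  by rewrite take0 wcoef_step_nil mul0r.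
rewrite add0r.
have [->|w0] := eqVneq w [::].
  rewrite big_ord0 addr0 /=; case: eqP => [_|_]; last by rewrite big_nil raddf0.
  rewrite big_seq1 wcoef1 /marked_weight marks_nil.
  by rewrite fpowerset0 big_seq_fset1 big_seq_fset0.
rewrite raddfMn /= wcoef1 (negPf w0) mul0rn add0r.
(* For a nonempty word, the first-cut recursion is applied to each walk reading [w]; the cut
   positions depend on [w] alone, so the sums can be exchanged. *)
transitivity (\sum_(s < size w) \sum_(al <- walk_seq G P w i j)
   irreducible_weight (mark_weight x) (take s.+1 al) *
   marked_weight (mark_weight x) (drop s.+1 al)).
  rewrite exchange_big /=; apply: eq_big_seq => al /walk_seqP[_ rw].
  have al0 : al != [::] by rewrite -size_eq0 -(size_map fst) -/(rho al) rw size_eq0.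
  by rewrite marked_weight_rec // -rw size_map.
apply: eq_bigr => s _; rewrite -[bump 0 s]/s.+1.
rewrite -{1}(cat_take_drop s.+1 w) big_walk_seq_cat; apply: eq_bigr => k _.
rewrite wcoef_step wcoef_walk_gf big_distrlr /=.
apply: eq_big_seq => al /walk_seqP[_ rw]; apply: eq_bigr => ga _.
have sal : size al = s.+1.
  by rewrite -(size_map fst) -/(rho al) rw size_takel.
by rewrite take_size_cat // drop_size_cat.
Qed.

End Marks.

(* A matrix [X] without terms in the empty word strictly increases word length,
   so [1 - X] is cancellable on the left. *)
Lemma mulmx_fixpoint_eq0 (A I : choiceType) (K : comPzRingType) (m : nat)
    (X Y : 'M[wseries A I K]_m) :
  (forall i j, wcoef [::] (X i j) = 0) -> Y = X *m Y -> Y = 0.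
Proof.
move=> X0 YX; apply/matrixP => i j; apply: wcoefP => w; rewrite mxE raddf0.
(* Induction on word length; the row [i] is generalised because the product moves to another row,
   while the column stays fixed. *)
have [n] := ubnP (size w); elim: n w i => // n IH w i wn.
rewrite YX mxE raddf_sum big1 //= => k _; rewrite wcoefM.
rewrite big_ord_recl take0 X0 mul0r add0r big1 // => s _.
rewrite IH ?mulr0 // lift0 size_drop.
by rewrite ltn_subLR ?ltn_ord // (leq_trans wn) // addSn ltnS leq_addl.
Qed.

Theorem theorem4 (A : countType) (I : countType) (K : fieldType)
    (charK : [pchar K] =i pred0)
    (beta : I -> seq A) (beta_inj : injective beta)
    (beta_size : forall k, (2 <= size (beta k))%N)
    (m : nat) (G : rel 'I_m) (P : 'I_m -> 'I_m -> set A)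
    (netGP : monoid_network G P) :
  let F : 'M[wseries A I K]_m := walk_gf G P K beta in
  let D : 'M[wseries A I K]_m :=
    1%:M - mxfsum (Pset G P) (Mletter K)
         - cluster_mx G P beta (fun k => tvar k - 1) in
  F *m D = 1%:M /\ D *m F = 1%:M.
Proof.
move=> F D.
pose X : 'M[wseries A I K]_m :=
  mxfsum (Pset G P) (Mletter K) + cluster_mx G P beta (fun k => tvar k - 1).
have DE : D = 1%:M - X by rewrite opprD addrA.
have DF : D *m F = 1%:M.
  rewrite DE mulmxBl mul1mx; apply/eqP; rewrite subr_eq; apply/eqP.
  exact: (walk_gf_rec G P beta_inj beta_size).
split; last exact: DF.
apply: subr0_eq.
apply: (@mulmx_fixpoint_eq0 _ _ _ _ X) => [i j|].
  exact: (wcoef_step_nil G P beta_inj beta_size).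
(* The right inverse shows that [D] annihilates this difference; with [D] equal to 1 - [X] this is
   the fixpoint equation. *)
have : D *m (F *m D - 1%:M) = 0.
  by rewrite mulmxBr mulmxA DF mul1mx mulmx1 subrr.
by rewrite {1}DE mulmxBl mul1mx => /eqP; rewrite subr_eq0 => /eqP.
Qed.
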